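(* Let $X$ be an hls-space whose topology is Tychonoff. Then $X$ is hls-normal if and only if, for each closed subset $Y$ of $X$, the closure $\overline{Y}$ of $Y$ in the Higson compactification $h(X)$ is the Higson compactification of $Y$ (where $Y$ carries the subspace topology and subspace ls-structure).
   Context: For $B\subseteq X$ and a family $\mathcal{U}$ of subsets of $X$, $\mathrm{st}(B,\mathcal{U})$ is the union of the elements of $\mathcal{U}$ meeting $B$; for a family $\mathcal{B}$, $\mathrm{st}(\mathcal{B},\mathcal{U})=\{\mathrm{st}(B,\mathcal{U})\mid B\in\mathcal{B}\}$. A large scale structure (ls-structure) on a set $X$ is a nonempty collection $\mathcal{L}$ of families of subsets of $X$ (the uniformly bounded families) such that: (i) if $\mathcal{B}_1\in\mathcal{L}$ and each element of $\mathcal{B}_2$ having more than one point is contained in some element of $\mathcal{B}_1$, then $\mathcal{B}_2\in\mathcal{L}$; (ii) $\mathcal{B}_1,\mathcal{B}_2\in\mathcal{L}$ implies $\mathrm{st}(\mathcal{B}_1,\mathcal{B}_2)\in\mathcal{L}$. A hybrid large scale space (hls-space) is a set with an ls-structure and a topology such that some uniformly bounded cover consists of open sets. The subspace ls-structure on $Y\subseteq X$ consists of the families of subsets of $Y$ that are uniformly bounded in $X$. A subset is bounded if it is an element of some uniformly bounded cover. The coarse component of a point $x$ is the union of all bounded sets containing $x$. A subset is weakly bounded if its intersection with every coarse component is bounded. A map $f:X\to M$ to a metric space is slowly oscillating if for every uniformly bounded family $\mathcal{U}$ and every $\varepsilon>0$ there is a weakly bounded set $K$ such that $\mathrm{diam}(f(U))<\varepsilon$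 for every $U\in\mathcal{U}$ with $U\cap K=\varnothing$. For an hls-space $X$ with Tychonoff (completely regular Hausdorff) topology, the Higson compactification $h(X)$ is the Hausdorff compactification of $X$ corresponding to the algebra of all continuous bounded slowly oscillating functions on $X$; i.e. the (unique up to equivalence) Hausdorff compactification such that a continuous function $f:X\to[0,1]$ extends continuously to $h(X)$ if and only if $f$ is slowly oscillating. $N$ is a coarse neighbourhood of $A$ if $A\subseteq N$ and for every uniformly bounded cover $\mathcal{U}$, $\mathrm{st}(A,\mathcal{U})\subseteq N\cup K$ for some weakly bounded $K$. $N$ is a topological neighbourhood of $A$ if $N$ contains an open set containing $\mathrm{cl}(A)$. $N$ is a hybrid neighbourhood of $A$ if it is both. An hls-space $X$ is hls-normal if for every closed $A\subseteq X$ and every hybrid neighbourhood $N$ of $A$ there is a closed $V\subseteq X$ such that $V$ is a hybrid neighbourhood of $A$ and $N$ is a hybrid neighbourhood of $V$. *)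

(* Defs.v *)
From HB Require Import structures.
From mathcomp Require Import all_boot all_order all_algebra.
From mathcomp Require Import all_classical all_reals all_analysis.

Set Implicit Arguments.
Unset Strict Implicit.
Unset Printing Implicit Defensive.

Import Order.TTheory GRing.Theory Num.Theory.
Import numFieldNormedType.Exports.

Local Open Scope classical_set_scope.
Local Open Scope ring_scope.

Section large_scale.
Context {X : Type}.
Implicit Types (A B K N : set X) (U V : set (set X)) (L : set (set (set X))).

Definition star B U : set X :=
  \bigcup_(A in [set A | U A /\ A `&` B !=set0]) A.

Definition star_family V U : set (set X) := [set star B U | B in V].

Definition is_cover U := \bigcup_(A in U) A = [set: X].

Definition has_two_points A := exists x y, [/\ A x, A y & x <> y].

Record ls_structure L : Prop := {
  ls_nonempty : L !=set0 ;
  ls_refine : forall U V, L U ->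
    (forall B, V B -> has_two_points B -> exists2 A, U A & B `<=` A) -> L V ;
  ls_star : forall U V, L U -> L V -> L (star_family U V) }.

Definition bounded_in L B := exists U, [/\ L U, is_cover U & U B].

Definition coarse_component L (x : X) : set X :=
  \bigcup_(B in [set B | bounded_in L B /\ B x]) B.

Definition weakly_bounded L K :=
  forall x, bounded_in L (K `&` coarse_component L x).

Definition coarse_neighbourhood L A N :=
  A `<=` N /\
  forall U, L U -> is_cover U ->
    exists2 K, weakly_bounded L K & star A U `<=` N `|` K.

Definition subspace_ls L (Y : set X) : set (set (set Y)) :=
  [set V | L [set set_val @` B | B in V]].

(* The supremum is taken in [0, +oo], so that the diameter of set0 is 0. *)
Definition diameter {R : realType} {M : metricType R} (A : set M) : \bar R :=
  maxe 0%E (ereal_sup [set (mdist x y)%:E | x in A & y in A]).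

Definition slowly_oscillating {R : realType} {M : metricType R} L
    (f : X -> M) :=
  forall U (eps : R), L U -> 0 < eps ->
    exists2 K, weakly_bounded L K &
      forall A, U A -> A `&` K = set0 -> (diameter (f @` A) < eps%:E)%E.

End large_scale.
Arguments subspace_ls {X} L Y.

Section hybrid.
Context {X : topologicalType}.
Implicit Types (A N : set X) (L : set (set (set X))).

Record hls_space L : Prop := {
  hls_ls : ls_structure L ;
  hls_open_cover : exists U, [/\ L U, is_cover U & U `<=` open] }.

Definition topological_neighbourhood A N :=
  exists O, [/\ open O, closure A `<=` O & O `<=` N].

Definition hybrid_neighbourhood L A N :=
  coarse_neighbourhood L A N /\ topological_neighbourhood A N.

Definition hls_normal L :=
  forall A N, closed A -> hybrid_neighbourhood L A N ->
    exists V, [/\ closed V, hybrid_neighbourhood L A V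
                & hybrid_neighbourhood L V N].

Definition tychonoff_space :=
  completely_regular_space X /\ hausdorff_space X.

End hybrid.
Arguments tychonoff_space X : clear implicits.

Section compactification.
Context {X K : topologicalType}.

Definition topological_embedding (e : X -> K) :=
  [/\ injective e, continuous e &
      forall U, open U -> exists2 V, open V & e @` U = V `&` range e].

Definition hausdorff_compactification (e : X -> K) :=
  [/\ compact [set: K], hausdorff_space K, topological_embedding e
    & dense (range e)].

(* Slow oscillation is taken with respect to the metric |x - y| on R, whose
   metricType instance is carried by R^o. *)
Definition higson_compactification (R : realType) (L : set (set (set X)))
    (e : X -> K) :=
  hausdorff_compactification e /\
  forall f : X -> R, continuous f -> (forall x, 0 <= f x <= 1) ->
    ((exists F : K -> R, [/\ continuous F, (forall z, 0 <= F z <= 1)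
                           & F \o e = f])
     <-> slowly_oscillating L (f : X -> R^o)).

End compactification.
Arguments higson_compactification {X K} R L e.

Definition to_closure {X K : topologicalType} (e : X -> K) (Y : set X) (y : Y) :
    closure (e @` Y) :=
  exist _ (e (set_val y))
    (mem_set (subset_closure (imageP e (set_valP y)))).
Arguments to_closure {X K} e Y y.

Section subspace_hls.
Context {X : topologicalType} (L : set (set (set X))) (Y : set X).

Lemma image_star (B : set Y) (U : set (set Y)) :
  set_val @` star B U = star (set_val @` B) [set set_val @` A | A in U].
Proof.
apply/seteqP; split => [_ [x [A [UA [y [Ay By]]] Ax] <-]|x].
  exists (set_val @` A); last by exists x.
  by split; [exists A|exists (set_val y); split; exists y].
move=> [_ [[A UA <-] [_ [[y Ay <-] [z Bz zy]]]] [w Aw <-]].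
exists w => //; exists A => //; split=> //; exists y; split=> //.
by rewrite (_ : y = z) //; apply: val_inj; rewrite -set_valE.
Qed.

Lemma subspace_ls_structure :
  ls_structure L -> ls_structure (subspace_ls L Y).
Proof.
move=> [[U0 LU0] refine stL]; split.
- by exists set0; apply: (refine U0) => // B [A []].
- move=> U V LU UV; apply: refine LU _ => _ [B VB <-].
  move=> [a [b [[x Bx <-] [y By <-] xy]]]; have [|A UA BA] := UV B VB.
    by exists x, y; split=> // xy'; apply: xy; rewrite xy'.
  by exists (set_val @` A); [exists A|exact: image_subset].
- move=> U V LU LV; rewrite /subspace_ls/=.
  rewrite [X in L X](_ : _ = star_family [set set_val @` B | B in U]
    [set set_val @` B | B in V]); first exact: stL.
  apply/seteqP; split => [_ [_ [B UB <-] <-]|_ [_ [B UB <-] <-]].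
    by exists (set_val @` B); [exists B|rewrite image_star].
  by exists (star B V); [exists B|rewrite image_star].
Qed.

Lemma subspace_hls_space : hls_space L -> hls_space (subspace_ls L Y).
Proof.
move=> [lsL [U [LU coverU openU]]]; split; first exact: subspace_ls_structure.
exists [set set_val @^-1` A | A in U]; split.
- apply: (ls_refine lsL LU) => _ [_ [A UA <-] <-] _; exists A => //.
  exact: image_preimage_subset.
- apply/seteqP; split=> // y _.
  have [A UA Ay] : (\bigcup_(A in U) A) (set_val y) by rewrite coverU.
  by exists (set_val @^-1` A) => //; exists A.
- by move=> _ [A /openU oA <-]; exists A.
Qed.

End subspace_hls.

(* Main.v *)
(* Normality allows interpolation between hybrid neighbourhoods, so the dyadic
   construction of Urysohn's lemma yields continuous slowly oscillating
   functions.  For a slowly oscillating f on a closed subset Y, the sets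
   f <= a and f >= b with a < b are then separated by a function that extends
   to h(X), so they have disjoint closures there, and hence f extends to the
   closure of Y.  Conversely, if N is a hybrid neighbourhood of a closed set A,
   the function equal to 0 on A and to 1 off the interior of N is slowly
   oscillating on the union Y of these two closed sets; it extends to the
   closure of Y, then to h(X) by Tietze's theorem, and the sublevel set at 1/2
   of the restriction of this extension to X interpolates between A and N. *)
Require Import Defs.
From mathcomp Require Import all_boot all_order all_algebra.
From mathcomp Require Import all_classical all_reals all_analysis.
From mathcomp Require Import lra.

Set Implicit Arguments.
Unset Strict Implicit.
Unset Printing Implicit Defensive.

Import Order.TTheory GRing.Theory Num.Theory.
Import numFieldNormedType.Exports.

Local Open Scope classical_set_scope.
Local Open Scope ring_scope.

(** * Uniformly bounded families, bounded and weakly bounded sets *)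

Section large_scale_theory.
Context {X : Type} (L : set (set (set X))) (lsL : ls_structure L).
Implicit Types (A B K N : set X) (U V : set (set X)).

Lemma ls_sub U V : L U -> V `<=` U -> L V.
Proof.
by move=> LU VU; apply: (ls_refine lsL LU) => B /VU UB _; exists B.
Qed.

(** A singleton does not have two points, so refinement imposes nothing on it. Adjoining singletons
    turns any uniformly bounded family into a cover. *)
Lemma ls_setU1 U : L U -> L (U `|` range set1).
Proof.
move=> LU; apply: (ls_refine lsL LU) => B [UB _|[x _ <-] [a [b [-> -> //]]]].
by exists B.
Qed.

Lemma is_cover_setU1 U : is_cover (U `|` range set1).
Proof.
by apply/seteqP; split=> // x _; exists [set x] => //; right; exists x.
Qed.

Lemma sub_star U B : is_cover U -> B `<=` star B U.
Proof.
move=> cU x Bx; have [A UA Ax] : (\bigcup_(A in U) A) x by rewrite cU.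
by exists A => //; split=> //; exists x.
Qed.

(** With singletons adjoined, a member of [U] lies in its own star, and a member of [V] containing
    [a] lies in the star of [[set a]]; one use of the star axiom covers both. *)
Lemma ls_setU U V : L U -> L V -> L (U `|` V).
Proof.
move=> LU LV; have LU1 := ls_setU1 LU; have LV1 := ls_setU1 LV.
apply: (ls_refine lsL (ls_star lsL LU1 LV1)) => B UVB [a [_ [Ba _ _]]].
case: UVB => [UB|VB].
  by exists (star B (V `|` range set1)); [exists B => //; left|
    apply: sub_star; exact: is_cover_setU1].
exists (star [set a] (V `|` range set1)).
  by exists [set a] => //; right; exists a.
by move=> x Bx; exists B => //; split; [left|exists a].
Qed.

Lemma bounded_inP B : bounded_in L B <-> L [set B].
Proof.
split=> [[U [LU _ UB]]|LB]; first by apply: ls_sub LU _ => _ ->.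
exists ([set B] `|` range set1); split; [exact: ls_setU1|
  exact: is_cover_setU1|by left].
Qed.

Lemma bounded_in_elt U B : L U -> U B -> bounded_in L B.
Proof. by move=> LU UB; apply/bounded_inP/(ls_sub LU) => _ ->. Qed.

Lemma bounded_in_sub A B : bounded_in L B -> A `<=` B -> bounded_in L A.
Proof.
move=> /bounded_inP LB AB; apply/bounded_inP.
by apply: (ls_refine lsL LB) => _ -> _; exists B.
Qed.

Lemma bounded_in0 : bounded_in L set0.
Proof.
have [U LU] := ls_nonempty lsL; apply/bounded_inP.
by apply: (ls_refine lsL LU) => _ -> [x [y []]].
Qed.

Lemma bounded_in_star A U : L U -> bounded_in L A -> bounded_in L (star A U).
Proof.
move=> LU /bounded_inP LA; apply/bounded_inP.
by apply: ls_sub (ls_star lsL LA LU) _ => _ ->; exists A.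
Qed.

Lemma bounded_in_setU A B :
  bounded_in L A -> bounded_in L B -> A `&` B !=set0 ->
  bounded_in L (A `|` B).
Proof.
move=> bA bB [x [Ax Bx]]; have /bounded_inP LA := bA;
have /bounded_inP LB := bB.
apply: (bounded_in_sub (bounded_in_star (ls_setU LA LB) bA)) => y.
case=> [Ay|By]; first by exists A => //; split; [left|exists x].
by exists B => //; split; [right|exists x].
Qed.

Lemma coarse_componentP (x y : X) :
  coarse_component L x y <-> bounded_in L [set x; y].
Proof.
split=> [[B [bB Bx] By]|bxy].
  by apply: bounded_in_sub bB _ => z [->|->].
by exists [set x; y]; [split=> //; left|right].
Qed.

Lemma coarse_component_sub (x y : X) :
  coarse_component L x y -> coarse_component L y `<=` coarse_component L x.
Proof.
move=> /coarse_componentP xy z /coarse_componentP yz.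
have : bounded_in L ([set x; y] `|` [set y; z]).
  by apply: bounded_in_setU => //; exists y; split; [right|left].
by move=> b; exists ([set x; y] `|` [set y; z]);
  [split=> //; left; left|right; right].
Qed.

Lemma coarse_component_eq (x y : X) :
  coarse_component L x y -> coarse_component L y = coarse_component L x.
Proof.
move=> xy; apply/seteqP; split; first exact: coarse_component_sub.
apply: coarse_component_sub; apply/coarse_componentP.
by rewrite setUC; apply/coarse_componentP.
Qed.

Lemma coarse_component_bounded B (x y : X) :
  bounded_in L B -> B y -> coarse_component L x y ->
  B `<=` coarse_component L x.
Proof.
by move=> bB By xy z Bz; apply: (coarse_component_sub xy); exists B.
Qed.

Lemma weakly_bounded0 : weakly_bounded L set0.
Proof. by move=> x; rewrite set0I; exact: bounded_in0. Qed.

Lemma weakly_bounded_setU A B : weakly_bounded L A -> weakly_bounded L B ->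
  weakly_bounded L (A `|` B).
Proof.
move=> wA wB x; rewrite setIUl.
have [->|/set0P[a Aa]] := eqVneq (A `&` coarse_component L x) set0.
  by rewrite set0U.
have [->|/set0P[b Bb]] := eqVneq (B `&` coarse_component L x) set0.
  by rewrite setU0.
(* The two traces may be disjoint; this pair, bounded because its points share a component, links
   them. *)
have ab : bounded_in L [set a; b].
  apply/coarse_componentP; rewrite (coarse_component_eq Aa.2).
  exact: Bb.2.
have Aab : bounded_in L ((A `&` coarse_component L x) `|` [set a; b]).
  by apply: bounded_in_setU => //; exists a; split=> //; left.
have : bounded_in L ((A `&` coarse_component L x) `|` [set a; b]
    `|` (B `&` coarse_component L x)).
  by apply: bounded_in_setU => //; exists b; split=> //; right; right.
by move=> bAB; apply: bounded_in_sub bAB _ => y [?|?]; [left; left|right].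
Qed.

Lemma weakly_bounded_bigcup (n : nat) (K : nat -> set X) :
  (forall i, (i < n)%N -> weakly_bounded L (K i)) ->
  weakly_bounded L (\bigcup_(i in `I_n) K i).
Proof.
elim: n => [|n IH] wK; first by rewrite II0 bigcup_set0; exact: weakly_bounded0.
rewrite IIS bigcup_setU bigcup_set1; apply: weakly_bounded_setU; last exact: wK.
by apply: IH => i ilt; apply: wK; exact: ltnW.
Qed.

(** A member of [U] that meets a coarse component lies in it, so the trace of the star is contained
    in the star of the trace. *)
Lemma weakly_bounded_star K U : L U -> weakly_bounded L K ->
  weakly_bounded L (star K U).
Proof.
move=> LU wK x; apply: bounded_in_sub (bounded_in_star LU (wK x)) _.
move=> y [[A [UA [a [Aa Ka]]] Ay] xy]; exists A => //; split=> //.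
exists a; split=> //; split=> //.
exact: (coarse_component_bounded (bounded_in_elt LU UA) Ay xy).
Qed.

(** Adjoining singletons makes a cover and only enlarges the star. *)
Lemma coarse_neighbourhoodP A N : coarse_neighbourhood L A N <->
  A `<=` N /\ forall U, L U ->
    exists2 K, weakly_bounded L K & star A U `<=` N `|` K.
Proof.
split=> -[AN cAN]; split=> // U LU; last by move=> _; exact: cAN.
have [K wK sK] := cAN _ (ls_setU1 LU) (@is_cover_setU1 U).
exists K => // x [B [UB AB] Bx]; apply: sK; exists B => //.
by split=> //; left.
Qed.

End large_scale_theory.

(** * Bounded and weakly bounded sets of a subspace *)

Section subspace_large_scale.
Context {X : topologicalType} (L : set (set (set X))) (lsL : ls_structure L).
Context (Y : set X).

Lemma bounded_in_subspace (B : set Y) :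
  bounded_in (subspace_ls L Y) B <-> bounded_in L (set_val @` B).
Proof.
rewrite bounded_inP; last exact: subspace_ls_structure.
by rewrite (bounded_inP lsL) /subspace_ls/= image_set1.
Qed.

Lemma coarse_component_subspace (x y : Y) :
  coarse_component (subspace_ls L Y) x y <->
  coarse_component L (set_val x) (set_val y).
Proof.
rewrite coarse_componentP; last exact: subspace_ls_structure.
rewrite (coarse_componentP lsL) bounded_in_subspace.
by rewrite image_setU !image_set1.
Qed.

Lemma weakly_bounded_preimage (K : set X) :
  weakly_bounded L K -> weakly_bounded (subspace_ls L Y) (set_val @^-1` K).
Proof.
move=> wK x; apply/bounded_in_subspace.
apply: (bounded_in_sub lsL (wK (set_val x))) => _ [y [Ky xy] <-]; split=> //.
exact/coarse_component_subspace.
Qed.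

Lemma weakly_bounded_image (K : set Y) :
  weakly_bounded (subspace_ls L Y) K -> weakly_bounded L (set_val @` K).
Proof.
(* A component of [X] that meets the image is the component of some [k] in [Y], where the hypothesis
   on [K] applies. *)
move=> wK x; have [->|/set0P[_ [[k Kk <-] xk]]] :=
  eqVneq (set_val @` K `&` coarse_component L x) set0; first exact: bounded_in0.
have /bounded_in_subspace bk := wK k; apply: (bounded_in_sub lsL bk).
move=> _ [[y Ky <-]] xy; exists y => //; split=> //.
by apply/coarse_component_subspace; rewrite (coarse_component_eq lsL xk).
Qed.

End subspace_large_scale.

(** * Slow oscillation of real functions *)

Section slow_oscillation.
Context {R : realType} {X : Type} (L : set (set (set X))).

Lemma slowly_oscillatingP (f : X -> R) :
  slowly_oscillating L (f : X -> R^o) <->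
  forall U (eps : R), L U -> 0 < eps ->
    exists2 K, weakly_bounded L K &
      forall A x y, U A -> A `&` K = set0 -> A x -> A y -> `|f x - f y| < eps.
Proof.
split=> sof U eps LU eps0.
  have [K wK UK] := sof U eps LU eps0; exists K => // A x y UA AK Ax Ay.
  rewrite distrC -lte_fin; apply: le_lt_trans (UK A UA AK).
  rewrite /diameter le_max; apply/orP; right; apply: ereal_sup_ubound.
  by exists (f x); [exists x|exists (f y) => //; exists y].
(* A supremum of numbers below [eps] can equal [eps], hence the half. *)
have [K wK UK] := sof U (eps / 2) LU (ltac:(by rewrite divr_gt0)).
exists K => // A UA AK; apply: (@le_lt_trans _ _ (eps / 2)%:E); last first.
  by rewrite lte_fin ltr_pdivrMr// mulr_natr mulr2n ltrDl.
rewrite /diameter ge_max lee_fin divr_ge0 ?(ltW eps0)//=.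
apply: ge_ereal_sup => _ [_ [x Ax <-]] [_ [y Ay <-]] <-.
by rewrite lee_fin; apply/ltW; exact: (UK A).
Qed.

End slow_oscillation.

(** * Urysohn's dyadic construction for an abstract relation *)

Section dyadic_levels.
Context {X : Type} (near : set X -> set X -> Prop).
Hypothesis near_interpolate : forall A B, near A B ->
  exists V, near A V /\ near V B.
Hypothesis near_sub : forall A B, near A B -> A `<=` B.
Hypothesis nearTT : near setT setT.

(** [V n k] is the level of index [k / 2 ^ n]: each row repeats the previous one at even places and
    interpolates at odd places. *)
Lemma dyadic_levels A B : near A B -> near B setT ->
  exists V : nat -> nat -> set X,
    [/\ V 0%N 0%N = A, V 0%N 1%N = B,
        forall n k, V n.+1 k.*2 = V n k
      & forall n k, near (V n k) (V n k.+1)].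
Proof.
move=> AB BT.
have /choice[m mP] : forall CD : set X * set X, exists E,
    near CD.1 CD.2 -> near CD.1 E /\ near E CD.2.
  move=> CD; have [/near_interpolate[E]|nCD] := pselect (near CD.1 CD.2).
    by exists E.
  by exists setT.
pose refine (S : nat -> set X) k :=
  if odd k then m (S k./2, S k./2.+1) else S k./2.
(* After [B] the initial row is the whole space, so that consecutive terms are related at every
   index. *)
pose S0 k := if k is k'.+1 then if k' is _.+1 then setT else B else A.
exists (fun n => iter n refine S0); split=> //.
  by move=> n k; rewrite iterS /refine odd_double doubleK.
elim=> [[|[|k]]|n IH k] //=.
rewrite /refine /= uphalf_half; case: ifPn => /= ok; rewrite ?add1n ?add0n.
  by have [] := mP (_, _) (IH k./2).
by have [] := mP (_, _) (IH k./2).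
Qed.

(** [g x] is the infimum of 1 and of the dyadic numbers whose level contains [x]. For [t <= 1], the
    sets [C] and [D] are consecutive levels of a row fine enough to fit between [s] and [t]. *)
Lemma urysohn_levels (R : realType) A B : near A B -> near B setT ->
  exists g : X -> R,
    [/\ forall x, 0 <= g x <= 1, forall x, A x -> g x = 0,
        forall x, ~ B x -> g x = 1
      & forall s t, 0 <= s -> s < t -> exists C D, [/\ near C D,
          forall x, g x <= s -> C x & forall x, D x -> g x <= t]].
Proof.
move=> AB BT; have [V [VA VB Vdbl Vnear]] := dyadic_levels AB BT.
have Vmono n k l : (k <= l)%N -> V n k `<=` V n l.
  move=> kl; rewrite -(subnKC kl); elim: (l - k)%N => [|i IH].
    by rewrite addn0.
  by apply: (subset_trans IH); rewrite addnS; exact: near_sub (Vnear n _).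
have Vexp n k m : V (n + m)%N (k * 2 ^ m)%N = V n k.
  elim: m => [|m IH]; first by rewrite addn0 expn0 muln1.
  by rewrite addnS expnS mulnCA mul2n Vdbl.
have Vlt m j n k x : (j%:R / 2 ^+ m < k%:R / 2 ^+ n :> R) -> V m j x -> V n k x.
  rewrite ltr_pdivrMr ?exprn_gt0// mulrAC ltr_pdivlMr ?exprn_gt0//.
  rewrite -!natrX -!natrM ltr_nat => jk Vx.
  by rewrite -(Vexp n k m) addnC; apply: (Vmono _ _ _ (ltnW jk)); rewrite Vexp.
(* The element 1 keeps the set nonempty and caps [g] at 1. *)
pose E x : set R := [set r | r = 1 \/ exists n k, V n k x /\ r = k%:R / 2 ^+ n].
have lbE x : lbound (E x) 0.
  by move=> r [->//|[n [k [_ ->]]]]; rewrite divr_ge0 ?exprn_ge0.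
have E1 x : E x 1 by left.
have infE x r : E x r -> inf (E x) <= r by apply: ge_inf; exists 0.
have g01 x : 0 <= inf (E x) <= 1.
  by rewrite infE// andbT; apply: lb_le_inf; [exists 1|].
exists (fun x => inf (E x)); split=> // [x Ax|x nBx|s t s0 st].
- apply/eqP; rewrite eq_le (andP (g01 x)).1 andbT; apply: infE.
  by right; exists 0%N, 0%N; rewrite VA mul0r.
- apply/eqP; rewrite eq_le (andP (g01 x)).2/=;
  apply: lb_le_inf; first by exists 1.
  move=> r [->//|[n [k [Vx ->]]]]; rewrite leNgt; apply/negP => k1.
  by apply: nBx; rewrite -VB; apply: Vlt Vx; rewrite expr0 divr1.
have [t1|t1] := ltP 1 t.
  exists setT, setT; split=> // x _.
  by apply/ltW; apply: le_lt_trans t1; exact: (andP (g01 x)).2.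
(* As [2 ^ n * (t - s)] exceeds 2, taking for [k] one more than the integer part of [s * 2 ^ n]
   gives [s < k / 2 ^ n] and [k.+1 / 2 ^ n <= t]. *)
pose n := (Num.truncn (2 / (t - s))).+1.
have nst : 2 < (t - s) * 2 ^+ n.
  rewrite -ltr_pdivrMl ?subr_gt0// mulrC; apply: (lt_trans (truncnS_gt _)).
  by rewrite -natrX ltr_nat; exact: ltn_expl.
have p0 : 0 < 2 ^+ n :> R by rewrite exprn_gt0.
pose k := (Num.truncn (s * 2 ^+ n)).+1.
have sk : s * 2 ^+ n < k%:R by exact: truncnS_gt.
have ks : k%:R <= s * 2 ^+ n + 1.
  by rewrite /k -natr1 lerD2r truncn_le// mulr_ge0// ltW.
have kt : k.+1%:R / 2 ^+ n <= t.
  rewrite ler_pdivrMr// -natr1; move: nst ks; rewrite mulrBl; lra.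
exists (V n k), (V n k.+1); split=> // x.
  move=> gs; have : inf (E x) < k%:R / 2 ^+ n.
    by apply: (le_lt_trans gs); rewrite ltr_pdivlMr.
  move=> /inf_lt[|r [->|[m [j [Vx ->]]]]]; first by exists 1.
    (* The value 1 cannot lie below [k / 2 ^ n], which is less than [t <= 1]. *)
    move=> k1; have kk : k%:R / 2 ^+ n < k.+1%:R / 2 ^+ n :> R.
      by rewrite ltr_pM2r ?invr_gt0// ltr_nat.
    by have := lt_le_trans (lt_trans k1 kk) (le_trans kt t1); rewrite ltxx.
  by move=> jk; exact: Vlt jk Vx.
by move=> Vx; apply: le_trans kt; apply: infE; right; exists n, k.+1.
Qed.

End dyadic_levels.

(** * Continuity through rays, and sublevel sets *)

Section real_continuity.
Context {T : topologicalType} {R : realType}.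

Lemma continuous_rays (f : T -> R) :
  (forall x t, f x < t -> \forall y \near x, f y < t) ->
  (forall x t, t < f x -> \forall y \near x, t < f y) -> continuous f.
Proof.
move=> flt fgt x; apply/cvgrPdist_lt => e e0.
have fl : f x < f x + e by rewrite ltrDl.
have fg : f x - e < f x by rewrite ltrBlDr ltrDl.
apply: filterS2 (flt _ _ fl) (fgt _ _ fg) => y.
by rewrite ltr_norml; lra.
Qed.

Lemma closed_sublevel (g : T -> R) (s : R) : continuous g ->
  closed [set x | g x <= s].
Proof.
by move=> /continuous_closedP/(_ _ (@closed_le R s)).
Qed.

Lemma open_sublevel (g : T -> R) (s : R) : continuous g ->
  open [set x | g x < s].
Proof.
by move=> /continuousP/(_ _ (@open_lt R s)).
Qed.

End real_continuity.

(** * Hybrid neighbourhoods and the hybrid Urysohn lemma *)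

Section hybrid_theory.
Context {X : topologicalType} (L : set (set (set X))) (hlsX : hls_space L).
Let lsL := hls_ls hlsX.

Lemma hybrid_neighbourhood_sub (A A' N N' : set X) :
  A' `<=` A -> N `<=` N' -> hybrid_neighbourhood L A N ->
  hybrid_neighbourhood L A' N'.
Proof.
move=> AA NN [[AN cAN] [W [oW AW WN]]]; split; last first.
  by exists W; split=> //; [apply: subset_trans AW; exact: closureS|
    exact: subset_trans NN].
split; first exact: (subset_trans AA (subset_trans AN NN)).
move=> U LU cU; have [K wK sK] := cAN U LU cU.
exists K => // x [C [UC [y [Cy Ay]]] Cx].
have /sK[/NN|] : star A U x.
  by exists C => //; split=> //; exists y; split=> //; exact: AA.
  by left.
by right.
Qed.

Lemma hybrid_neighbourhoodT (A : set X) : hybrid_neighbourhood L A setT.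
Proof.
split; last by exists setT; split=> //; exact: openT.
split=> // U _ _; exists set0; first exact: weakly_bounded0.
by move=> x _; left.
Qed.

(** Take a uniformly bounded open cover [W]. A point [x] of the star of [A] not interior to [N] lies
    in a member of [W] with a point [z] outside [N]. This [z] is in the star of [A] for the
    thickened family, hence in [K], so [x] is in [star K W]. *)
Lemma coarse_neighbourhood_interior (A N : set X) :
  coarse_neighbourhood L A N -> A `<=` interior N ->
  coarse_neighbourhood L A (interior N).
Proof.
move=> /(coarse_neighbourhoodP lsL)[AN cAN] AN'; split=> // U LU cU.
have [W [LW cW oW]] := hls_open_cover hlsX.
have [K wK sK] := cAN _ (ls_star lsL LU LW).
exists (star K W); first exact: weakly_bounded_star.
move=> x [C [UC [a [Ca Aa]]] Cx].
have [Nx|Nx] := pselect (interior N x); [by left|right].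
have [w Ww wx] : (\bigcup_(w in W) w) x by rewrite cW.
have [z wz Nz] : exists2 z, w z & ~ N z.
  apply: contrapT => wN; apply: Nx; rewrite /interior nbhsE.
  exists w; first by split=> //; exact: oW.
  by move=> z wz; apply: contrapT => Nz; apply: wN; exists z.
have sCz : star C W z by exists w => //; split=> //; exists x.
have /sK[//|Kz] : star A (star_family U W) z.
  exists (star C W) => //; split; first by exists C.
  by exists a; split=> //; apply: sub_star Ca.
by exists w => //; split=> //; exists z.
Qed.

(** On a member of [U] that avoids [K], [g] varies by less than [t - s]; the members that meet [K]
    are absorbed by [star K U]. *)
Lemma hybrid_neighbourhood_sublevel (R : realType) (g : X -> R) (s t : R) :
  continuous g -> slowly_oscillating L (g : X -> R^o) -> s < t ->
  hybrid_neighbourhood L [set x | g x <= s] [set x | g x <= t].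
Proof.
move=> cg /slowly_oscillatingP sog st; split; last first.
  exists [set x | g x < t]; split; first exact: open_sublevel.
    have /closure_id <- := closed_sublevel (s := s) cg.
    by move=> x /= /le_lt_trans; apply.
  by move=> x /= /ltW.
split=> [x /= /le_trans|U LU _]; first by apply; exact: ltW.
have ts0 : 0 < t - s by rewrite subr_gt0.
have [K wK UK] := sog U _ LU ts0.
exists (star K U); first exact: weakly_bounded_star.
move=> x [C [UC [y [Cy /= gys]]] Cx].
have [CK|/set0P CK] := eqVneq (C `&` K) set0; last by right; exists C.
left; rewrite /=; have := UK C x y UC CK Cx Cy; rewrite ltr_norml; lra.
Qed.

Lemma hls_urysohn (R : realType) (A N : set X) :
  hls_normal L -> closed A -> hybrid_neighbourhood L A N ->
  exists g : X -> R, [/\ continuous g, forall x, 0 <= g x <= 1,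
    slowly_oscillating L (g : X -> R^o), forall x, A x -> g x = 0
  & forall x, ~ N x -> g x = 1].
Proof.
move=> normalX cA AN; have [V [cV AV VN]] := normalX _ _ cA AN.
(* Interpolation requires the first set to be closed. As [N] may fail to be closed, the construction
   starts from [A] and the closed set [V] inside [N]. *)
pose near B M := closed B /\ hybrid_neighbourhood L B M.
have near_interpolate B M : near B M -> exists W, near B W /\ near W M.
  by move=> [cB /(normalX _ _ cB)[W [cW BW WM]]]; exists W.
have near_sub B M : near B M -> B `<=` M by case=> _ [[]].
have nearT B : closed B -> near B setT.
  by move=> cB; split=> //; exact: hybrid_neighbourhoodT.
have [g [g01 gA gV glev]] := urysohn_levels near_interpolate near_sub
  (nearT _ closedT) R (conj cA AV) (nearT _ cV).
exists g; split=> //.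
(* Continuity comes from the topological half of [near], slow oscillation from its coarse half. *)
- apply: continuous_rays => x t.
    move=> gxt; have gt : g x < (g x + t) / 2 by lra.
    have [C [D [[_ [_ [W [oW CW WD]]]] gC gD]]] :=
      glev _ _ (proj1 (andP (g01 x))) gt.
    apply: (@filterS _ _ _ W) => [y /WD/gD|]; first by lra.
    by apply: open_nbhs_nbhs; split=> //; exact/CW/subset_closure/gC.
  (* Levels are available only for [0 <= s]; a negative [t] is below [g] everywhere. *)
  move=> tgx; have [t0|t0] := ltP t 0.
    by apply: nearW => y; apply: lt_le_trans t0 _;
      exact: (proj1 (andP (g01 y))).
  have tt : t < (g x + t) / 2 by lra.
  have [C [D [[_ [_ [W [oW CW WD]]]] gC gD]]] := glev _ _ t0 tt.
  apply: (@filterS _ _ _ (~` closure C)) => [y nCy|].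
    by rewrite ltNge; apply/negP => /gC/subset_closure.
  apply: open_nbhs_nbhs; split; first exact/closed_openC/closed_closure.
  by move=> /CW/WD/gD; lra.
- apply/slowly_oscillatingP => U eps LU eps0.
  (* The values are cut into steps of length [1 / m], and [K i] is the exceptional set for the
     passage from [i / m] to [i.+1 / m]. As [g <= 1], finitely many [K i] suffice. *)
  pose m := (Num.truncn (2 / eps)).+1; have m0 : 0 < m%:R :> R by [].
  have meps : 2 / m%:R < eps.
    by rewrite ltr_pdivrMr// mulrC -ltr_pdivrMr//; exact: truncnS_gt.
  have /choice[K KP] : forall i, exists K, weakly_bounded L K /\
      forall C x y, U C -> C x -> C y -> ~ K y ->
        g x <= i%:R / m%:R -> g y <= i.+1%:R / m%:R.
    move=> i; have im : i%:R / m%:R < i.+1%:R / m%:R :> R.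
      by rewrite ltr_pM2r ?invr_gt0// ltr_nat.
    have [|C [D [[_ [/(coarse_neighbourhoodP lsL)[_ CD] _]] gC gD]]] :=
      glev _ _ _ im; first by rewrite divr_ge0.
    have [K wK sK] := CD U LU; exists K; split=> // B x y UB Bx By Ky gx.
    have /sK[/gD//|//] : star C U y.
    by exists B => //; split=> //; exists x; split=> //; exact: gC.
  exists (\bigcup_(i in `I_m.+2) K i).
    by apply: (weakly_bounded_bigcup lsL) => i _; case: (KP i).
  move=> B x y UB BK.
  suff le2 a b : B a -> B b -> g b <= g a + 2 / m%:R.
    move=> Bx By; apply: le_lt_trans meps; rewrite ler_norml.
    by have := le2 _ _ Bx By; have := le2 _ _ By Bx; lra.
  move=> Ba Bb; have /andP[ga0 ga1] := g01 a.
  (* Rounding [g a] up to [i / m] costs at most [1 / m] and the passage another [1 / m]. For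
     [g a = 1] the index is [m.+1], whence the range [I_m.+2]. *)
  pose i := (Num.truncn (g a * m%:R)).+1.
  have gm0 : 0 <= g a * m%:R by rewrite mulr_ge0.
  have i_le : i%:R <= g a * m%:R + 1 by rewrite /i -natr1 lerD2r truncn_le.
  have im : (i < m.+2)%N.
    rewrite ltnS -(ler_nat R) -natr1; apply: (le_trans i_le).
    by rewrite lerD2r ler_piMl.
  have Kb : ~ K i b.
    by move=> Kb; rewrite -[False]/(set0 b) -BK; split=> //; exists i.
  apply: (le_trans ((KP i).2 B a b UB Ba Bb Kb _)).
    by rewrite ler_pdivlMr//; apply/ltW; exact: truncnS_gt.
  by rewrite ler_pdivrMr// mulrDl divfK ?gt_eqF// -natr1; lra.
- by move=> x Nx; apply: gV => Vx; apply: Nx; exact: (proj1 (proj1 VN)) Vx.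
Qed.

End hybrid_theory.

(** * Subspaces, and extension of functions by Tietze's theorem or by density *)

Section subtype_topology.
Context {X : topologicalType}.

Lemma set_val_continuous (A : set X) : continuous (set_val : A -> X).
Proof. exact: initial_continuous. Qed.

Lemma compact_set_type (A : set X) : compact A -> compact [set: A].
Proof.
move=> cA F FF _.
have [|p [Ap clp]] := cA (set_val @ F) (fmap_proper_filter _ FF).
  by apply: (@filterS _ F _ setT) => [y _|]; [exact: set_valP|exact: filterT].
exists (exist _ p (mem_set Ap)); split=> // U V FU [_ [[W oW <-] /= Wp] WV].
have [|_ [[y Uy <-] Wy]] :=
    clp (set_val @` U) W _ (open_nbhs_nbhs (conj oW Wp)).
  by apply: (@filterS _ F _ U) => // y Uy; exists y.
by exists y; split=> //; exact: WV.
Qed.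

Lemma hausdorff_set_type (A : set X) : hausdorff_space X -> hausdorff_space A.
Proof.
move=> hX p q pq; apply: val_inj; apply: hX => U V Up Vq.
have [y [Uy Vy]] := pq (set_val @^-1` U) (set_val @^-1` V)
  (set_val_continuous Up) (set_val_continuous Vq).
by exists (set_val y).
Qed.

Lemma closed_image_set_val (Y : set X) (C : set Y) :
  closed Y -> closed C -> closed (set_val @` C).
Proof.
move=> cY /closed_openC[W oW WC].
suff -> : set_val @` C = Y `&` ~` W.
  by apply: closedI => //; exact: open_closedC.
apply/seteqP; split=> [_ [y Cy <-]|x [Yx Wx]].
  by split; [exact: set_valP|move=> Wy; have : (~` C) y by rewrite -WC].
exists (exist _ x (mem_set Yx)) => //; apply: contrapT => nC; apply: Wx.
by rewrite -[W x]/((set_val @^-1` W) (exist _ x (mem_set Yx))) WC.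
Qed.

Lemma tietze_set_type (R : realType) (Z : set X) (F : Z -> R) :
  hausdorff_space X -> compact [set: X] -> closed Z ->
  continuous F -> (forall z, 0 <= F z <= 1) ->
  exists G : X -> R, [/\ continuous G, forall x, 0 <= G x <= 1
    & forall z, G (set_val z) = F z].
Proof.
move=> hX cX cZ cF F01.
have valLE (z : Z) : valL_ 0 F (set_val z) = F z.
  by rewrite -[LHS]/(sigL Z (valL_ 0 F) z) valLK.
have [] := @continuous_bounded_extension X R (compact_normal hX cX) Z cZ
  (valL_ 0 F) 1 ltr01.
- exact/subspace_valL_continuousP'.
- move=> x Zx; rewrite -[x]/(set_val (exist _ x (mem_set Zx) : Z)) valLE.
  by have /andP[F0 F1] := F01 (exist _ x (mem_set Zx)); rewrite ger0_norm.
(* Tietze's theorem gives values in [[-1, 1]]; the absolute value changes nothing on [Z], where [F]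
   is nonnegative. *)
move=> g [gF cg g1]; exists (fun x => `|g x|); split.
- by move=> x; apply: cvg_norm; exact: cg.
- by move=> x; rewrite normr_ge0 g1.
move=> z; rewrite -gF; last exact: valP.
by rewrite valLE ger0_norm//; have /andP[] := F01 z.
Qed.

End subtype_topology.

(* The value of the extension at [z] is the infimum of the levels [a] such that
   [z] is adherent to the image of [f x <= a]. *)
Lemma extend_of_separated_levels (T : Type) (K : topologicalType) (R : realType)
    (e : T -> K) (f : T -> R) :
  dense (range e) -> (forall x, 0 <= f x <= 1) ->
  (forall a b, a < b -> exists G : K -> R, [/\ continuous G,
     forall x, f x <= a -> G (e x) = 0 & forall x, b <= f x -> G (e x) = 1]) ->
  exists F : K -> R,
    [/\ continuous F, forall z, 0 <= F z <= 1 & F \o e = f].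
Proof.
move=> de f01 sep.
pose C a := closure (e @` [set x | f x <= a]).
pose E z := [set a | 0 <= a /\ C a z].
have lbE z : lbound (E z) 0 by move=> a [].
have E1 z : E z 1.
  split=> // B; rewrite nbhsE => -[W [oW Wz] WB].
  have [|w [Ww [x _ xw]]] := de W _ oW; first by exists z.
  exists (e x); split; last by apply: WB; rewrite xw.
  by exists x => //=; have /andP[] := f01 x.
have infE z a : E z a -> inf (E z) <= a by apply: ge_inf; exists 0.
have F01 z : 0 <= inf (E z) <= 1.
  by rewrite infE// andbT; apply: lb_le_inf; [exists 1|].
have CG a (G : K -> R) z : continuous G ->
    (forall x, f x <= a -> G (e x) = 0) -> C a z -> G z = 0.
  move=> cG G0 Cz; have cl0 : closed (G @^-1` [set 0]).
    by move/continuous_closedP: cG; apply; exact: closed_eq.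
  suff : closure (G @^-1` [set 0]) z by rewrite -(closure_id _).1.
  by apply: closureS Cz => _ [x fx <-]; exact: G0.
exists (fun z => inf (E z)); split=> //; last first.
  apply/funext => x /=; apply/eqP; rewrite eq_le; apply/andP; split.
    apply: infE; split; first by have /andP[] := f01 x.
    by apply: subset_closure; exists x => /=.
  apply: lb_le_inf; first by exists 1.
  move=> a [a0 Ca]; rewrite leNgt; apply/negP => afx.
  have [G [cG G0 G1]] := sep _ _ afx.
  by have := CG _ _ _ cG G0 Ca; rewrite G1// => /eqP; rewrite oner_eq0.
apply: continuous_rays => z t.
  move=> /inf_lt[|a [a0 Ca] at_]; first by exists 1.
  have ab : a < (a + t) / 2 by lra.
  have [G [cG G0 G1]] := sep _ _ ab.
  (* By density, every [y] with [G y < 1] is adherent to points [e x] with [G (e x) < 1], which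
     forces [f x <= (a + t) / 2]. *)
  apply: (@filterS _ _ _ [set y | G y < 1]) => [y Gy|].
    apply: (@le_lt_trans _ _ ((a + t) / 2)); last by lra.
    apply: infE; split=> [|B]; first by lra.
    rewrite nbhsE => -[W [oW Wy] WB].
    have oWG : open (W `&` [set y | G y < 1]).
      by apply: openI => //; exact: open_sublevel.
    have [|w [[Ww Gw] [x _ xw]]] := de _ _ oWG; first by exists y.
    exists (e x); split; last by apply: WB; rewrite xw.
    exists x => //=; rewrite leNgt; apply/negP => /ltW/G1.
    by rewrite xw; move: Gw => /= + G1'; rewrite G1' ltxx.
  apply: open_nbhs_nbhs; split; first exact: open_sublevel.
  by rewrite /= (CG _ _ _ cG G0 Ca) ltr01.
move=> tFz; have [t0|t0] := ltP t 0.
  by apply: nearW => y; apply: lt_le_trans t0 _; exact: (proj1 (andP (F01 y))).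
pose s := (t + inf (E z)) / 2; have ts : t < s by rewrite /s; lra.
apply: (@filterS _ _ _ (~` C s)) => [y nCy|].
  apply: lt_le_trans ts _; apply: lb_le_inf; first by exists 1.
  move=> a [a0 Ca]; rewrite leNgt; apply/negP => as_; apply: nCy.
  apply: closureS Ca => _ [x /= fx <-]; exists x => //=.
  by apply: (le_trans fx); exact: ltW.
apply: open_nbhs_nbhs; split; first exact/closed_openC/closed_closure.
move=> Cs; have : inf (E z) <= s by apply: infE; split=> //; lra.
by rewrite /s; lra.
Qed.

Lemma hausdorff_compactification_closure (X K : topologicalType) (e : X -> K)
    (Y : set X) :
  hausdorff_compactification e -> hausdorff_compactification (to_closure e Y).
Proof.
move=> [cK hK [inje ce oe] de]; split.
- apply: compact_set_type; apply: subclosed_compact cK _ => //.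
  exact: closed_closure.
- exact: hausdorff_set_type.
- split.
  + move=> x y /(congr1 val) /= /inje xy; exact: val_inj.
  + apply: continuous_comp_initial => x; apply: (@continuous_comp Y X K) => //.
      exact: set_val_continuous.
    exact: ce.
  + move=> _ [U oU <-]; have [V oV UV] := oe U oU.
    exists (set_val @^-1` V); first by exists V.
    apply/seteqP; split=> [_ [y Uy <-]|z [Vz [y _ yz]]].
      split; last by exists y.
      have : (e @` U) (e (set_val y)) by exists (set_val y).
      by rewrite UV => -[].
    rewrite -yz in Vz *; exists y => //.
    have : (V `&` range e) (e (set_val y)) by split=> //; exists (set_val y).
    by rewrite -UV => -[u Uu /inje uy]; rewrite /preimage /= -uy.
- move=> O [z Wz] [W oW WE]; rewrite -WE in Wz *.
  have [|_ [[x Yx <-] Wx]] := set_valP z W; first exact: open_nbhs_nbhs.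
  by exists (to_closure e Y (exist _ x (mem_set Yx))).
Qed.

(** * Slow oscillation on a subspace *)

Section subspace_slow_oscillation.
Context {R : realType} {X : topologicalType} (L : set (set (set X))).
Context (hlsX : hls_space L) (Y : set X).
Let lsL := hls_ls hlsX.

Lemma slowly_oscillating_subspace (g : X -> R) :
  slowly_oscillating L (g : X -> R^o) ->
  slowly_oscillating (subspace_ls L Y) (g \o set_val : Y -> R^o).
Proof.
move=> /slowly_oscillatingP sog; apply/slowly_oscillatingP => U eps LU eps0.
have [K wK UK] := sog _ _ LU eps0.
exists (set_val @^-1` K); first exact: weakly_bounded_preimage.
move=> A x y UA AK Ax Ay; apply: (UK (set_val @` A)) => //.
  by exists A.
apply/seteqP; split=> // _ [[z Az <-] Kz].
by rewrite -[set0 _]/(set0 z) -AK.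
Qed.

(** The traces on [Y] of the members of [U] are uniformly bounded. A trace that avoids [K] cannot
    meet both [f <= a] and [b <= f]; the other members are absorbed by the star of the image of
    [K]. *)
Lemma hybrid_neighbourhood_of_slowly_oscillating (f : Y -> R) (a b : R) :
  closed Y -> continuous f ->
  slowly_oscillating (subspace_ls L Y) (f : Y -> R^o) -> a < b ->
  hybrid_neighbourhood L (set_val @` [set y | f y <= a])
    (~` (set_val @` [set y | b <= f y])).
Proof.
move=> cY cf /slowly_oscillatingP sof ab.
have cA : closed (set_val @` [set y | f y <= a]).
  by apply: closed_image_set_val => //; exact: closed_sublevel.
have cB : closed (set_val @` [set y | b <= f y]).
  apply: closed_image_set_val => //.
  by move/continuous_closedP: cf => /(_ _ (@closed_ge R b)).
have disj : set_val @` [set y | f y <= a]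
    `<=` ~` (set_val @` [set y | b <= f y]).
  move=> _ [y fy <-] [z fz /val_inj zy]; move: fy fz; rewrite /= zy; lra.
split; last first.
  exists (~` (set_val @` [set y | b <= f y])); split=> //.
    exact: closed_openC.
  by rewrite -(closure_id _).1.
split=> // U LU _.
have LU' : subspace_ls L Y [set set_val @^-1` C | C in U].
  apply: (ls_refine lsL LU) => _ [_ [C UC <-] <-] _; exists C => //.
  exact: image_preimage_subset.
have ba0 : 0 < b - a by rewrite subr_gt0.
have [K wK UK] := sof _ _ LU' ba0.
exists (star (set_val @` K) U).
  by apply: weakly_bounded_star => //; exact: weakly_bounded_image.
move=> x [C [UC [w [Cy [y fy yw]]]] Cx]; rewrite -{}yw in Cy.
have [[z fz zx]|] := pselect ((set_val @` [set y | b <= f y]) x); last by left.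
right; have [CK|/set0P[k [Ck Kk]]] :=
    eqVneq ((set_val @^-1` C : set Y) `&` K) set0.
  have : `|f z - f y| < b - a.
    by apply: UK CK _ _ => //=; [exists C|rewrite zx].
  by move: fy fz; rewrite ltr_norml /=; lra.
by exists C => //; split=> //; exists (set_val k); split=> //; exists k.
Qed.

End subspace_slow_oscillation.

(** * The two implications *)

Section higson.
Context {R : realType} {X : topologicalType} (L : set (set (set X))).
Context (hlsX : hls_space L).
Context {hX : topologicalType} (h : X -> hX).
Hypothesis higsonX : higson_compactification R L h.
Let lsL := hls_ls hlsX.

(** Tietze's theorem extends [F] to [hX], and the restriction of the extension to [X] is slowly
    oscillating by the defining property of [hX]. Both implications use this. *)
Lemma higson_extension_of_closure (Y : set X)
    (F : closure (h @` Y) -> R) :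
  continuous F -> (forall z, 0 <= F z <= 1) ->
  exists g : X -> R, [/\ continuous g, forall x, 0 <= g x <= 1,
    slowly_oscillating L (g : X -> R^o) & g \o set_val = F \o to_closure h Y].
Proof.
move=> cF F01; have [[cK hK [_ ch _] _] so] := higsonX.
have [G [cG G01 GF]] :=
  tietze_set_type hK cK (@closed_closure _ _) cF F01.
have cg : continuous (G \o h).
  by move=> x; apply: continuous_comp; [exact: ch|exact: cG].
exists (G \o h); split=> //; first by move=> x; exact: G01.
  by apply/(so _ cg) => [x|]; [exact: G01|exists G].
by apply/funext => y; rewrite /= -GF.
Qed.

Lemma higson_closure_of_hls_normal (Y : set X) :
  hls_normal L -> closed Y ->
  higson_compactification R (subspace_ls L Y) (to_closure h Y).
Proof.
move=> normalX cY; have [hcX so] := higsonX.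
have [cK hK [_ ch _] _] := hcX.
have [cK' hK' eY dY] := hausdorff_compactification_closure Y hcX.
split=> // f cf f01; split.
  move=> [F [cF F01 <-]].
  have [g [_ _ sog <-]] := higson_extension_of_closure cF F01.
  exact: slowly_oscillating_subspace.
move=> sof; apply: extend_of_separated_levels => // a b ab.
have cA : closed (set_val @` [set y | f y <= a]).
  by apply: closed_image_set_val => //; exact: closed_sublevel.
have [g [cg g01 sog gA gB]] := hls_urysohn hlsX R normalX cA
  (hybrid_neighbourhood_of_slowly_oscillating hlsX cY cf sof ab).
have [_ /(_ sog)[G [cG _ Gg]]] := so g cg g01.
exists (G \o set_val); split.
- move=> z; apply: continuous_comp; [exact: set_val_continuous|exact: cG].
- move=> y fy; rewrite -[LHS]/((G \o h) (set_val y)) Gg; apply: gA.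
  by exists y.
- move=> y fy; rewrite -[LHS]/((G \o h) (set_val y)) Gg; apply: gB.
  by apply; exists y.
Qed.

Lemma hls_normal_of_higson_closure :
  (forall Y : set X, closed Y ->
    higson_compactification R (subspace_ls L Y) (to_closure h Y)) ->
  hls_normal L.
Proof.
move=> higsonY A N clA AN.
have AN' : A `<=` interior N.
  move: AN => [_ [W [oW AW WN]]] x Ax; rewrite /interior nbhsE.
  by exists W => //; split=> //; exact/AW/subset_closure.
(* Replacing [N] by its interior makes [Y] closed and keeps the coarse condition. *)
have cAN := coarse_neighbourhood_interior hlsX AN.1 AN'.
pose Y := A `|` ~` interior N.
have cY : closed Y.
  by apply: closedU => //; apply: open_closedC; exact: open_interior.
pose f (y : Y) : R := if pselect (A (set_val y)) then 0 else 1.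
have f0 y : A (set_val y) -> f y = 0 by rewrite /f; case: pselect.
have f1 y : ~ A (set_val y) -> f y = 1 by rewrite /f; case: pselect.
have YN (y : Y) : interior N (set_val y) -> A (set_val y).
  by case: (set_valP y).
have f01 y : 0 <= f y <= 1.
  by rewrite /f; case: pselect => ?; rewrite lexx ler01.
have cf : continuous f.
  (* [f] is locally constant: [A] is closed, and it is open in [Y] as the trace of [interior N]. *)
  have fc y : \forall z \near y, f y = f z.
    have [Ay|nAy] := pselect (A (set_val y)).
      apply: (@filterS _ _ _ (set_val @^-1` interior N)) => [z Nz|].
        by rewrite !f0//; exact: YN.
      apply: set_val_continuous; apply: open_nbhs_nbhs.
      by split; [exact: open_interior|exact: AN'].
    apply: (@filterS _ _ _ (set_val @^-1` (~` A))) => [z Nz|].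
      by rewrite !f1.
    apply: set_val_continuous; apply: open_nbhs_nbhs.
    by split=> //; exact: closed_openC.
  by apply: continuous_rays => y t fy; apply: filterS (fc y) => z <-.
have sof : slowly_oscillating (subspace_ls L Y) (f : Y -> R^o).
  apply/slowly_oscillatingP => U eps LU eps0.
  have [K wK sK] := (proj2 ((coarse_neighbourhoodP lsL _ _).1 cAN)) _ LU.
  exists (set_val @^-1` K); first exact: weakly_bounded_preimage.
  (* A member that avoids [K] and meets [A] has all its points in [interior N], hence in [A]; so [f]
     is constant on members avoiding [K]. *)
  have mixed C x y : U C -> C `&` set_val @^-1` K = set0 -> C x -> C y ->
      A (set_val x) -> A (set_val y).
    move=> UC CK Cx Cy Ax.
    have /sK[/YN//|Ky] : star A [set set_val @` B | B in U] (set_val y).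
      exists (set_val @` C); last by exists y.
      by split; [exists C|exists (set_val x); split=> //; exists x].
    by exfalso; rewrite -[False]/(set0 y) -CK.
  move=> C x y UC CK Cx Cy.
  have [Ax|nAx] := pselect (A (set_val x)).
    by rewrite !f0 ?subrr ?normr0//; exact: (mixed C x).
  rewrite !f1 ?subrr ?normr0// => Ay; apply: nAx; exact: (mixed C y).
have [F [cF F01 Ff]] := (proj2 ((higsonY Y cY).2 f cf f01)) sof.
have [g [cg g01 sog gF]] := higson_extension_of_closure cF F01.
have gf (x : X) (Yx : Y x) : g x = f (exist _ x (mem_set Yx)).
  by rewrite -Ff -gF.
(* [g] is 0 on [A] and 1 off [interior N], so the sublevel sets at 0, 1/2 and 2/3 are nested between
   [A] and [N]. *)
have half : 0 < 1 / 2 :> R by lra.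
have half' : 1 / 2 < 2 / 3 :> R by lra.
exists [set x | g x <= 1 / 2]; split.
- exact: closed_sublevel.
- apply: hybrid_neighbourhood_sub
    (hybrid_neighbourhood_sublevel hlsX cg sog half) => //.
  by move=> x Ax; rewrite /= (gf x (or_introl Ax)) f0.
- apply: hybrid_neighbourhood_sub
    (hybrid_neighbourhood_sublevel hlsX cg sog half') => //.
  move=> x /= gx; apply: contrapT => nNx.
  have nix : (~` interior N) x by move=> /interior_subset.
  move: gx; rewrite (gf x (or_intror nix)) f1; first by lra.
  by move=> /AN'.
Qed.

End higson.

Theorem proposition9p3 (R : realType) (X : topologicalType)
    (L : set (set (set X))) (hlsX : hls_space L) (tychX : tychonoff_space X)
    (hX : topologicalType) (h : X -> hX)
    (higsonX : higson_compactification R L h) :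
  hls_normal L <->
  forall Y : set X, closed Y ->
    higson_compactification R (subspace_ls L Y) (to_closure h Y).
Proof.
split; last exact: (hls_normal_of_higson_closure hlsX higsonX).
by move=> normalX Y; exact: higson_closure_of_hls_normal.
Qed.
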